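(* Let $2\leqslant m\leqslant n$ be integers and let $\Theta$ be a proper real $n\times m$ matrix. Let $\psi$ be a continuous positive function, monotonically decreasing to $0$ as $t\to+\infty$, with $\psi(t)=o(t^{-1})$ as $t\to+\infty$, and suppose that $\Theta$ is $\psi$-singular. Then $R(\Theta)\geqslant 3$.
   Context: $\Theta=(\theta^i_j)$, $1\leqslant j\leqslant n$, $1\leqslant i\leqslant m$, is a real $n\times m$ matrix with associated linear forms $L_j(\mathbf x)=\sum_{i=1}^m\theta^i_jx_i$, $\mathbf x=(x_1,\dots,x_m)\in\mathbb Z^m$. $\|\cdot\|$ denotes distance to the nearest integer. Put $M(\mathbf x)=\max_i|x_i|$, $\zeta(\mathbf x)=\max_j\|L_j(\mathbf x)\|$. A nonzero $\mathbf x\in\mathbb Z^m$ is a best approximation if $\zeta(\mathbf x)\leqslant\zeta(\mathbf x')$ for every nonzero $\mathbf x'\in\mathbb Z^m$ with $M(\mathbf x')\leqslant M(\mathbf x)$. The values $M(\mathbf x)$, $\zeta(\mathbf x)$ of best approximations form sequences $M_1<M_2<\cdots$ and $\zeta_1>\zeta_2>\cdots$; $\mathbf x_\nu$ denotes a best approximation with $M(\mathbf x_\nu)=M_\nu$, and its extended vector is $\mathbf z_\nu=(\mathbf x_\nu,y_{1,\nu},\dots,y_{n,\nu})\in\mathbb Z^{m+n}$, where $y_{j,\nu}\in\mathbb Z$ satisfies $|L_j(\mathbf x_\nu)+y_{j,\nu}|=\|L_j(\mathbf x_\nu)\|$. $\Theta$ is called proper if these sequences are infinite and for every sufficiently large $\nu$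 the best approximation $\mathbf x_\nu$ is unique up to sign. For proper $\Theta$, $R(\Theta)$ is the least $r$ such that there exist a lattice $\Lambda\subseteq\mathbb Z^{m+n}$ whose linear span has dimension $r$ and $\nu_0$ with $\mathbf z_\nu\in\Lambda$ for all $\nu\geqslant\nu_0$. Given a continuous positive $\psi$ decreasing to $0$ with $\psi(t)=o(t^{-m/n})$, $\Theta$ is $\psi$-singular if for every sufficiently large real $t$ the system $\max_j\|L_j(\mathbf x)\|\leqslant\psi(t)$, $0<M(\mathbf x)<t$ has a solution $\mathbf x\in\mathbb Z^m$. *)

(* Defs.v *)
From HB Require Import structures.
From mathcomp Require Import all_boot all_order all_algebra.
From mathcomp Require Import all_classical all_reals all_analysis.

Set Implicit Arguments.
Unset Strict Implicit.
Unset Printing Implicit Defensive.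

Import Order.TTheory GRing.Theory Num.Theory.
Import numFieldNormedType.Exports.

Local Open Scope classical_set_scope.
Local Open Scope ring_scope.

(* Lets the Landau notations be used at [+oo]. *)
Canonical pinfty_filter_on (R : numFieldType) := FilterType (pinfty_nbhs R) _.

Definition dist_int (R : realType) (a : R) : R :=
  inf [set `|a - k%:~R| | k in [set: int]].

(* [Theta j i] is the coefficient of x_i in the j-th linear form. *)
Definition linform (R : realType) (m n : nat) (Theta : 'M[R]_(n, m))
    (j : 'I_n) (x : 'cV[int]_m) : R :=
  \sum_(i < m) Theta j i * (x i 0)%:~R.

Definition height (m : nat) (x : 'cV[int]_m) : nat :=
  (\max_(i < m) `|x i 0%R|)%N.

Definition zeta (R : realType) (m n : nat) (Theta : 'M[R]_(n, m))
    (x : 'cV[int]_m) : R :=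
  \big[Num.max/0]_(j < n) dist_int (linform Theta j x).

Definition best_approx (R : realType) (m n : nat) (Theta : 'M[R]_(n, m))
    (x : 'cV[int]_m) : Prop :=
  x != 0 /\
  forall x' : 'cV[int]_m, x' != 0 -> (height x' <= height x)%N ->
    zeta Theta x <= zeta Theta x'.

(* An infinite sequence of best approximations realizing the values
   M_1 < M_2 < ... and zeta_1 > zeta_2 > ....  Two best approximations of
   different heights may have the same [zeta]; as the zeta_nu strictly decrease,
   M_nu is then the least height at which the value zeta_nu is attained.
   Without the strict decrease, the multiples of a vector with [zeta] zero
   would form such a sequence. *)
Definition best_approx_seq (R : realType) (m n : nat) (Theta : 'M[R]_(n, m))
    (x : nat -> 'cV[int]_m) : Prop :=
  [/\ forall nu, best_approx Theta (x nu),
      forall nu, (height (x nu) < height (x nu.+1))%N,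
      forall nu, zeta Theta (x nu.+1) < zeta Theta (x nu)
    & forall x', best_approx Theta x' -> exists nu,
        zeta Theta x' = zeta Theta (x nu) /\ (height (x nu) <= height x')%N].

Definition proper_mx (R : realType) (m n : nat) (Theta : 'M[R]_(n, m)) : Prop :=
  exists2 x : nat -> 'cV[int]_m, best_approx_seq Theta x &
    exists nu0 : nat, forall nu, (nu0 <= nu)%N ->
      forall x', best_approx Theta x' -> height x' = height (x nu) ->
        x' = x nu \/ x' = - x nu.

(* [z nu] is the column (x_nu, y_{1,nu}, ..., y_{n,nu}). *)
Definition extended_seq (R : realType) (m n : nat) (Theta : 'M[R]_(n, m))
    (z : nat -> 'cV[int]_(m + n)) : Prop :=
  best_approx_seq Theta (fun nu => usubmx (z nu)) /\
  forall nu (j : 'I_n),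
    `|linform Theta j (usubmx (z nu)) + (dsubmx (z nu) j 0)%:~R| =
      dist_int (linform Theta j (usubmx (z nu))).

(* [U] is the smallest real subspace containing [Lambda]. *)
Definition is_linear_span (R : realType) (d : nat)
    (Lambda : zmodClosed 'cV[int]_d) (U : {vspace 'cV[R]_d}) : Prop :=
  let contains (V : {vspace 'cV[R]_d}) :=
    forall z : 'cV[int]_d, z \in Lambda -> map_mx intr z \in V in
  contains U /\ forall V : {vspace 'cV[R]_d}, contains V -> (U <= V)%VS.

(* For proper [Theta] any two extended sequences eventually agree up to sign
   and up to the choice of the nearest integer when it is not unique; the latter
   choice disappears for large nu since zeta_nu tends to 0.  So it does
   not matter which extended sequence is taken. *)
Definition tail_dim (R : realType) (m n : nat) (Theta : 'M[R]_(n, m))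
    (r : nat) : Prop :=
  exists Lambda : zmodClosed 'cV[int]_(m + n),
    (exists2 U : {vspace 'cV[R]_(m + n)}, is_linear_span Lambda U & \dim U = r)
    /\ exists2 z : nat -> 'cV[int]_(m + n), extended_seq Theta z &
         exists nu0 : nat, forall nu, (nu0 <= nu)%N -> z nu \in Lambda.

(* The least element of [tail_dim Theta]; the default 0 is only taken when there
   is no extended sequence, hence never for proper [Theta]. *)
Definition best_approx_dim (R : realType) (m n : nat) (Theta : 'M[R]_(n, m)) :
    nat :=
  xget 0%N [set r | tail_dim Theta r /\
                    forall s, tail_dim Theta s -> (r <= s)%N].

Definition psi_singular (R : realType) (m n : nat) (Theta : 'M[R]_(n, m))
    (psi : R -> R) : Prop :=
  \forall t \near +oo, exists x : 'cV[int]_m,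
    [/\ zeta Theta x <= psi t, (0 < height x)%N & (height x)%:R < t].

(* Main.v *)
(* If the extended best approximations z_nu with nu >= nu0 lay in a plane, the
   Pluecker coordinates of (z_nu, z_{nu+1}) would be those of
   (z_{nu0}, z_{nu0+1}) times a common factor D_nu.  One of the latter is a
   nonzero integer P, so |D_nu| >= 1/|P|.  On the other hand, in the coordinates
   x_i, L_j(x) + y_j some mixed coordinate of (z_{nu0}, z_{nu0+1}) is nonzero,
   since M_nu increases while zeta_nu decreases, and the mixed coordinates of
   (z_nu, z_{nu+1}) are at most 2 zeta_nu M_{nu+1}, which tends to 0 because
   zeta_nu <= psi(M_{nu+1}) = o(1 / M_{nu+1}). *)
Require Import Defs.
From HB Require Import structures.
From mathcomp Require Import all_boot all_order all_algebra.
From mathcomp Require Import all_classical all_reals all_analysis.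
From mathcomp Require Import ring lra zify.

Set Implicit Arguments.
Unset Strict Implicit.
Unset Printing Implicit Defensive.

Import Order.TTheory GRing.Theory Num.Theory.
Import numFieldNormedType.Exports.

Local Open Scope classical_set_scope.
Local Open Scope ring_scope.

(** * Nearest integers and the sup norm *)

(** The minimum is reached at the floor of [a] or at its successor, each being the closest integer
    on its side of [a]. *)
Lemma dist_int_attained (R : realType) (a : R) :
  exists k : int, dist_int a = `|a - k%:~R|.
Proof.
pose f := Num.floor a.
have /andP[fa af] : f%:~R <= a < (f + 1)%:~R := floor_itv a.
have [k lek] : exists k : int, forall l : int, `|a - k%:~R| <= `|a - l%:~R|.
  have lowf l : l <= f -> `|a - f%:~R| <= `|a - l%:~R|.
    rewrite -(ler_int R) => lf; rewrite !ger0_norm ?subr_ge0 //.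
      by rewrite lerD2l lerN2.
    exact: le_trans fa.
  have upf l : f + 1 <= l -> `|a - (f + 1)%:~R| <= `|a - l%:~R|.
    rewrite -(ler_int R) => fl; rewrite !ler0_norm ?subr_le0 ?(ltW af) //.
      by rewrite !opprB lerD2r.
    exact: le_trans (ltW af) fl.
  have lfl l : l <= f \/ f + 1 <= l by rewrite lezD1; apply/orP; case: leP.
  have [le|/ltW le] := leP `|a - f%:~R| `|a - (f + 1)%:~R|.
    exists f => // l; have [/lowf//|/upf] := lfl l; exact: le_trans.
  exists (f + 1) => // l; have [/lowf|/upf//] := lfl l; exact: le_trans.
exists k; apply/eqP; rewrite eq_le; apply/andP; split.
  apply: ge_inf; last by exists k.
  by exists 0 => _ [l _ <-].
apply: lb_le_inf; first by exists `|a - k%:~R|, k.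
by move=> _ [l _ <-].
Qed.

Lemma cV_normE (R : realType) (d : nat) (u : 'cV[R]_d) :
  `|u| = \big[Num.max/0]_(i < d) `|u i 0|.
Proof.
rewrite [LHS]/Num.Def.normr /= mx_normrE; apply/eqP; rewrite eq_le; apply/andP; split.
  apply/bigmax_leP; split=> [|[i k] _ /=]; first by apply: bigmax_ge_id.
  by rewrite (ord1 k); apply: (le_bigmax _ (fun i => `|u i 0|)).
apply/bigmax_leP; split=> [|i _]; first by apply: bigmax_ge_id.
exact: (le_bigmax _ (fun ij : 'I_d * 'I_1 => `|u ij.1 ij.2|) (i, 0)).
Qed.

Lemma coord_le_norm (R : realType) (d : nat) (u : 'cV[R]_d) (i : 'I_d) :
  `|u i 0| <= `|u|.
Proof. by rewrite cV_normE; apply: (le_bigmax _ (fun i => `|u i 0|)). Qed.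

Lemma norm_height (R : realType) (m : nat) (x : 'cV[int]_m) :
  `|map_mx intr x : 'cV[R]_m| = (height x)%:R.
Proof.
rewrite cV_normE /height.
rewrite (big_morph (fun k : nat => k%:R : R) (id1 := 0) (op1 := Num.max)) //.
  by apply: eq_bigr => i _; rewrite mxE -intr_norm -abszE.
by move=> a b; rewrite -natr_max.
Qed.

Lemma height_eq0 (m : nat) (x : 'cV[int]_m) : (height x == 0)%N = (x == 0).
Proof.
apply/idP/eqP => [|->].
  rewrite -leqn0 => /bigmax_leqP h; apply/colP => i; rewrite mxE.
  by apply/eqP; rewrite -absz_eq0 -leqn0 h.
by rewrite -leqn0; apply/bigmax_leqP => i _; rewrite mxE.
Qed.

(** * Best approximations and their minimality *)

(** Only finitely many integer vectors have height at most [height x0]; a nonzero one minimizing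
    [zeta] among them is a best approximation. *)
Lemma best_approx_below (R : realType) (m n : nat) (Theta : 'M[R]_(n, m))
    (x0 : 'cV[int]_m) : x0 != 0 ->
  exists x, [/\ best_approx Theta x, (height x <= height x0)%N
    & zeta Theta x <= zeta Theta x0].
Proof.
move=> x0N0; set H := height x0.
(* Shifting by [H] turns the [2H + 1] ordinals into the integers from [-H] to [H], so [g] enumerates
   the box by a finite type. *)
pose g (v : 'cV['I_(H.*2.+1)]_m) : 'cV[int]_m := \col_i ((v i 0)%:Z - H%:Z).
have gP x : (height x <= H)%N -> exists v, g v = x.
  move=> /bigmax_leqP hx; exists (\col_i inord (absz (x i 0 + H%:Z))).
  by apply/colP => i; rewrite !mxE inordK; have := hx i isT; lia.
have gH v : (height (g v) <= H)%N.
  apply/bigmax_leqP => i _; rewrite mxE; have := ltn_ord (v i 0); lia.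
have [v0 gv0] := gP x0 (leqnn H).
have gv0N0 : g v0 != 0 by rewrite gv0.
case: (@arg_minP _ _ _ v0 (fun v => g v != 0) (fun v => zeta Theta (g v)) gv0N0).
move=> v gvN0 vmin.
exists (g v); split; [split=> // y yN0 hy| exact: gH|by rewrite -gv0 vmin //= gv0].
have [w gw] := gP y (leq_trans hy (gH v)).
by rewrite -gw; apply: vmin; rewrite gw.
Qed.

(** A best approximation below [y] has the [zeta] of some [x mu] no higher than [y]; increasing
    heights force [mu <= nu], and [zeta] decreases along the sequence. *)
Lemma zeta_le_before_next (R : realType) (m n : nat) (Theta : 'M[R]_(n, m))
    (x : nat -> 'cV[int]_m) (nu : nat) (y : 'cV[int]_m) :
  best_approx_seq Theta x -> y != 0 -> (height y < height (x nu.+1))%N ->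
  zeta Theta (x nu) <= zeta Theta y.
Proof.
move=> [_ hx zx cx] yN0 hy.
have [y' [by' hy' zy']] := best_approx_below Theta yN0.
have [mu [zmu hmu]] := cx y' by'.
apply: le_trans zy'; rewrite zmu.
have hom_h := homo_leq (@leqnn) (@leq_trans) (fun k => ltnW (hx k)).
have lemu : (mu <= nu)%N.
  rewrite leqNgt; apply/negP => /hom_h.
  by rewrite leqNgt (leq_ltn_trans hmu) // (leq_ltn_trans hy').
by have /nonincreasing_seqP := fun k => ltW (zx k); apply.
Qed.

(** * Pluecker coordinates and the change of variables *)

(** The 2 x 2 minor in rows [k], [l] of the matrix with columns [u], [v]. *)
Definition plucker (K : pzRingType) (d : nat) (k l : 'I_d)
    (u v : 'cV[K]_d) : K :=
  u k 0 * v l 0 - u l 0 * v k 0.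

(** A Cauchy-Binet formula summed over all ordered pairs; its linearity in the minors lets a common
    factor pass through [A]. *)
Lemma plucker_mulmx (K : comPzRingType) (d e : nat) (A : 'M[K]_(e, d))
    (k l : 'I_e) (u v : 'cV[K]_d) :
  plucker k l (A *m u) (A *m v) =
    \sum_a \sum_b A k a * A l b * plucker a b u v.
Proof.
rewrite /plucker !mxE !big_distrlr /=.
rewrite [X in _ - X]exchange_big -sumrB; apply: eq_bigr => a _.
by rewrite -sumrB; apply: eq_bigr => b _; ring.
Qed.

Lemma plucker_comb (K : comPzRingType) (d : nat) (k l : 'I_d) (u v : 'cV[K]_d)
    (a b c e : K) :
  plucker k l (a *: u + b *: v) (c *: u + e *: v) =
    (a * e - b * c) * plucker k l u v.
Proof. by rewrite /plucker !mxE; ring. Qed.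

Lemma plucker_intr (K : pzRingType) (d : nat) (k l : 'I_d) (u v : 'cV[int]_d) :
  plucker k l (map_mx intr u) (map_mx intr v) = (plucker k l u v)%:~R :> K.
Proof. by rewrite /plucker !mxE intrB !intrM. Qed.

(** A nonzero coordinate makes [e1], [e2] independent, hence a basis of [U]; [D] is the determinant
    of [u], [v] in this basis. *)
Lemma plucker_plane (K : fieldType) (d : nat) (U : {vspace 'cV[K]_d})
    (k l : 'I_d) (e1 e2 u v : 'cV[K]_d) :
  (\dim U <= 2)%N -> e1 \in U -> e2 \in U -> u \in U -> v \in U ->
  plucker k l e1 e2 != 0 ->
  exists D : K, forall a b, plucker a b u v = D * plucker a b e1 e2.
Proof.
move=> dimU e1U e2U uU vU pN0.
have free12 : free [:: e1; e2].
  rewrite free_cons span_seq1 seq1_free; apply/andP; split.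
    apply: contra pN0 => /vlineP[c ->].
    by apply/eqP; rewrite /plucker !mxE; ring.
  by apply: contra pN0 => /eqP ->; apply/eqP; rewrite /plucker !mxE; ring.
have sub12 : (<<[:: e1; e2]>> <= U)%VS.
  by apply/span_subvP => w; rewrite !inE => /orP[] /eqP->.
have comb w : w \in U -> exists a b, w = a *: e1 + b *: e2.
  have /eqP <- : <<[:: e1; e2]>>%VS == U.
    by rewrite eqEdim sub12 (eqP free12).
  rewrite span_cons span_seq1 => /memv_addP[w1 /vlineP[a ->] [w2 /vlineP[b ->] ->]].
  by exists a, b.
have [a [b ->]] := comb u uU; have [c [e ->]] := comb v vU.
by exists (a * e - b * c) => i j; rewrite plucker_comb.
Qed.

(* If all of them vanished, v would be a multiple c u of u, and the
   two inequalities would require both |c| > 1 and |c| < 1. *)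
Lemma plucker_block_neq0 (R : realType) (m n : nat) (u v : 'cV[R]_(m + n)) :
  `|usubmx u| < `|usubmx v| -> `|dsubmx v| < `|dsubmx u| ->
  exists (j : 'I_n) (i : 'I_m), plucker (rshift m j) (lshift n i) u v != 0.
Proof.
move=> hu hv; apply: contrapT => none.
have prop j i : dsubmx u j 0 * usubmx v i 0 = usubmx u i 0 * dsubmx v j 0.
  rewrite !mxE; apply/eqP; rewrite -subr_eq0; apply: contrapT => ne.
  by apply: none; exists j, i; apply/negP.
have dN0 : dsubmx u != 0 by rewrite -normr_gt0 (le_lt_trans _ hv).
have /cV0Pn[j uj] := dN0.
have vN0 : usubmx v != 0 by rewrite -normr_gt0 (le_lt_trans _ hu).
have /cV0Pn[i vi] := vN0.
have Ev : usubmx v = (dsubmx v j 0 / dsubmx u j 0) *: usubmx u.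
  apply/colP => l; rewrite [RHS]mxE; apply: (mulfI uj); rewrite prop.
  by field.
move: (_ / _) Ev => c Ev.
(* Cancelling this entry in [prop] gives the same factor [c] on the lower blocks. *)
have ui : usubmx u i 0 != 0.
  by apply: contra vi => /eqP ui0; rewrite Ev mxE ui0 mulr0.
have Ed : dsubmx v = c *: dsubmx u.
  apply/colP => l; rewrite [RHS]mxE; apply: (mulfI ui).
  rewrite -prop Ev [X in _ * X = _]mxE.
  by ring.
move: hu hv; rewrite Ev Ed !normrZ => hu hv.
have c1 : 1 <= `|c|.
  rewrite leNgt; apply/negP => c1.
  by move: hu; rewrite ltNge ler_piMl // ltW.
by move: hv; rewrite ltNge ler_peMl.
Qed.

(* The coordinates of [shear Theta z] are the x_i and the L_j(x) + y_j. *)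
Definition shear (R : realType) (m n : nat) (Theta : 'M[R]_(n, m))
    (z : 'cV[int]_(m + n)) : 'cV[R]_(m + n) :=
  block_mx 1%:M 0 Theta 1%:M *m map_mx intr z.

Lemma usubmx_shear (R : realType) (m n : nat) (Theta : 'M[R]_(n, m))
    (z : 'cV[int]_(m + n)) :
  usubmx (shear Theta z) = map_mx intr (usubmx z).
Proof.
rewrite /shear -{1}(vsubmxK z) map_col_mx mul_block_col.
by rewrite mul1mx mul0mx addr0 col_mxKu.
Qed.

Lemma dsubmx_shear (R : realType) (m n : nat) (Theta : 'M[R]_(n, m))
    (z : 'cV[int]_(m + n)) (j : 'I_n) :
  dsubmx (shear Theta z) j 0 =
    linform Theta j (usubmx z) + (dsubmx z j 0)%:~R.
Proof.
rewrite /shear -{1}(vsubmxK z) map_col_mx mul_block_col !mul1mx col_mxKd.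
rewrite [LHS]mxE; congr (_ + _); last by rewrite mxE.
by rewrite mxE; apply: eq_bigr => i _; rewrite [X in _ * X]mxE.
Qed.

(** * Existence of extended sequences and of the least dimension *)

Lemma extended_seq_exists (R : realType) (m n : nat) (Theta : 'M[R]_(n, m)) :
  proper_mx Theta -> exists z, extended_seq Theta z.
Proof.
move=> [x xP _].
(* The sign changes because [dist_int] measures [a - k] while extended vectors use
   [L_j(x) + y_j]. *)
pose y nu j := - sval (cid (dist_int_attained (linform Theta j (x nu)))).
exists (fun nu => col_mx (x nu) (\col_j y nu j)); split.
  by under eq_fun do rewrite col_mxKu.
move=> nu j; rewrite col_mxKu col_mxKd mxE /y.
by case: cid => k /= ->; rewrite rmorphN.
Qed.

(** The full lattice of integer vectors works; it contains the standard basis, so it spans the whole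
    space. *)
Lemma tail_dim_exists (R : realType) (m n : nat) (Theta : 'M[R]_(n, m)) :
  proper_mx Theta -> exists r, tail_dim Theta r.
Proof.
move=> /extended_seq_exists[z zP].
have predTZ : zmod_closed [pred _ : 'cV[int]_(m + n) | true] by [].
pose predTM := GRing.isZmodClosed.Build _ _ predTZ.
pose Lambda : zmodClosed 'cV[int]_(m + n) :=
  HB.pack (pred_of_simpl [pred _ : 'cV[int]_(m + n) | true]) predTM.
exists (\dim (fullv : {vspace 'cV[R]_(m + n)})), Lambda; split.
  exists fullv => //; split=> [w _|V VP]; first exact: memvf.
  apply/subvP => w _; rewrite (matrix_sum_delta w).
  apply: memv_suml => i _; apply: memv_suml => j _; apply: memvZ.
  by have := VP (delta_mx i j) isT; rewrite map_delta_mx.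
by exists z => //; exists 0%N.
Qed.

(** A least element exists by well-ordering, so [xget] does not return its default 0. *)
Lemma best_approx_dimP (R : realType) (m n : nat) (Theta : 'M[R]_(n, m)) :
  proper_mx Theta -> tail_dim Theta (best_approx_dim Theta).
Proof.
move=> /tail_dim_exists[r0 r0P].
have ex : exists r, `[< tail_dim Theta r >] by exists r0; apply/asboolP.
have [r /asboolP rP rmin] := ex_minnP ex.
rewrite /best_approx_dim; case: xgetP => [_ _ [] //|/(_ r) []].
by split=> // s sP; apply/rmin/asboolP.
Qed.

(** * Mixed coordinates of consecutive best approximations *)

Lemma norm_shear_upper (R : realType) (m n : nat) (Theta : 'M[R]_(n, m))
    (z : 'cV[int]_(m + n)) :
  `|usubmx (shear Theta z)| = (height (usubmx z))%:R.
Proof. by rewrite usubmx_shear norm_height. Qed.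

Lemma norm_shear_lower (R : realType) (m n : nat) (Theta : 'M[R]_(n, m))
    (z : nat -> 'cV[int]_(m + n)) (nu : nat) :
  extended_seq Theta z ->
  `|dsubmx (shear Theta (z nu))| = zeta Theta (usubmx (z nu)).
Proof.
move=> [_ zP]; rewrite cV_normE; apply: eq_bigr => j _.
by rewrite dsubmx_shear zP.
Qed.

Lemma plucker_shear_neq0 (R : realType) (m n : nat) (Theta : 'M[R]_(n, m))
    (z : nat -> 'cV[int]_(m + n)) (nu : nat) :
  extended_seq Theta z -> exists (j : 'I_n) (i : 'I_m),
  plucker (rshift m j) (lshift n i)
    (shear Theta (z nu)) (shear Theta (z nu.+1)) != 0.
Proof.
move=> zP; apply: plucker_block_neq0.
  by rewrite !norm_shear_upper ltr_nat; case: zP => -[].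
by rewrite !norm_shear_lower //; case: zP => -[].
Qed.

(** One product is at most [zeta_nu M_{nu+1}] directly, the other is at most [zeta_{nu+1} M_nu],
    which is no larger by monotonicity. *)
Lemma plucker_shear_le (R : realType) (m n : nat) (Theta : 'M[R]_(n, m))
    (z : nat -> 'cV[int]_(m + n)) (nu : nat) (j : 'I_n) (i : 'I_m) :
  extended_seq Theta z ->
  `|plucker (rshift m j) (lshift n i)
     (shear Theta (z nu)) (shear Theta (z nu.+1))| <=
    2 * (zeta Theta (usubmx (z nu)) * (height (usubmx (z nu.+1)))%:R).
Proof.
move=> zP; have [[_ hx zx _] _] := zP.
rewrite mulrDl mul1r; apply: le_trans (ler_normB _ _) _.
have U mu : `|shear Theta (z mu) (lshift n i) 0| <= (height (usubmx (z mu)))%:R.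
  rewrite -(norm_shear_upper Theta).
  by have := coord_le_norm (usubmx (shear Theta (z mu))) i; rewrite mxE.
have D mu : `|shear Theta (z mu) (rshift m j) 0| <= zeta Theta (usubmx (z mu)).
  rewrite -norm_shear_lower //.
  by have := coord_le_norm (dsubmx (shear Theta (z mu))) j; rewrite mxE.
rewrite !normrM; apply: lerD; first exact: ler_pM.
rewrite mulrC; apply: ler_pM => //; first exact: le_trans (D _) (ltW (zx _)).
by apply: le_trans (U _) _; rewrite ler_nat ltnW.
Qed.

(** Singularity at [t = M_{nu+1}] yields a nonzero [y] of height strictly below [M_{nu+1}], so
    [zeta_nu <= zeta(y) <= psi(M_{nu+1})]. *)
Lemma singular_product_small (R : realType) (m n : nat) (Theta : 'M[R]_(n, m))
    (psi : R -> R) (x : nat -> 'cV[int]_m) (eps : R) (nu0 : nat) :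
  psi =o_+oo (fun t : R => t^-1) -> psi_singular Theta psi ->
  best_approx_seq Theta x -> 0 < eps ->
  exists2 nu, (nu0 <= nu)%N & zeta Theta (x nu) * (height (x nu.+1))%:R <= eps.
Proof.
move=> /eqoP psi_o sing xP eps0; have [_ hx _ _] := xP.
have height_ge nu : (nu <= height (x nu))%N.
  by elim: nu => // nu IH; apply: leq_ltn_trans IH (hx nu).
have [A [_ AP]] := filterI (psi_o _ eps0) sing.
(* Strictly increasing heights give [M_{nu+1} >= nu + 1], which exceeds [A] for this [nu]. *)
exists (maxn nu0 (Num.truncn A)); first exact: leq_maxl.
set nu := maxn _ _; set M := height (x nu.+1).
have M0 : 0 < M%:R :> R by rewrite ltr0n (leq_trans _ (height_ge nu.+1)).
have AM : A < M%:R.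
  apply: lt_le_trans (truncnS_gt A) _; rewrite ler_nat.
  by apply: leq_trans (height_ge nu.+1); rewrite ltnS leq_maxr.
have [psiM [y [zy hy0 hyM]]] := AP _ AM.
rewrite -ler_pdivlMr //; apply: (@le_trans _ _ (psi M%:R)); last first.
  by apply: le_trans (ler_norm _) (le_trans psiM _); rewrite gtr0_norm ?invr_gt0.
apply: le_trans zy; apply: zeta_le_before_next xP _ _.
  by rewrite -height_eq0 -lt0n.
by rewrite -(ltr_nat R).
Qed.

(** * Contradiction from a plane containing the tail *)

Theorem theorem8 (R : realType) (m n : nat) (Theta : 'M[R]_(n, m))
    (psi : R -> R)
    (hm : (2 <= m)%N) (hmn : (m <= n)%N)
    (Theta_proper : proper_mx Theta)
    (psi_cont : {in `]0, +oo[, continuous psi})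
    (psi_pos : forall t : R, 0 < t -> 0 < psi t)
    (psi_decr : forall s t : R, 0 < s -> s <= t -> psi t <= psi s)
    (psi_cvg0 : psi t @[t --> +oo] --> 0)
    (psi_o : psi =o_+oo (fun t : R => t^-1))
    (Theta_singular : psi_singular Theta psi) :
  (3 <= best_approx_dim Theta)%N.
Proof.
have := best_approx_dimP Theta_proper.
move: (best_approx_dim Theta) => r [Lambda [[U [UP _] <-] [z zP [nu0 inL]]]].
rewrite ltnNge; apply/negP => dimU.
have inU nu : (nu0 <= nu)%N -> map_mx intr (z nu) \in U by move=> /inL/UP.
have [j [i w0]] := plucker_shear_neq0 nu0 zP.
(* If all integer minors vanished, so would their linear images, among them the one in [w0]. *)
have [a [b P0]] : exists a b, plucker a b (z nu0) (z nu0.+1) != 0.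
  apply: contrapT => none; move: w0; rewrite plucker_mulmx.
  rewrite big1 ?eqxx // => a _; rewrite big1 // => b _; rewrite plucker_intr.
  have [->|P0] := eqVneq (plucker a b (z nu0) (z nu0.+1)) 0.
    by rewrite mulr0.
  by case: none; exists a, b.
set w := plucker _ _ _ _ in w0.
set P : R := (plucker a b (z nu0) (z nu0.+1))%:~R.
have PN0 : P != 0 by rewrite intr_eq0.
(* The 4 makes the upper bound [2 eps] only half of the lower bound [|w| / |P|] for [|D| |w|]. *)
have eps0 : 0 < `|w| / `|P| / 4 by rewrite !divr_gt0 ?normr_gt0.
have [nu le_nu small] :=
  singular_product_small nu0 psi_o Theta_singular zP.1 eps0.
have PR0 : plucker a b (map_mx intr (z nu0)) (map_mx intr (z nu0.+1)) != 0 :> R.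
  by rewrite plucker_intr.
have [D DP] := plucker_plane dimU (inU _ (leqnn _)) (inU _ (leqnSn _))
  (inU _ le_nu) (inU _ (leqW le_nu)) PR0.
have DS k l : plucker k l (shear Theta (z nu)) (shear Theta (z nu.+1)) =
    D * plucker k l (shear Theta (z nu0)) (shear Theta (z nu0.+1)).
  rewrite !plucker_mulmx mulr_sumr; apply: eq_bigr => c _.
  by rewrite mulr_sumr; apply: eq_bigr => d _; rewrite DP mulrCA.
have DN0 : D != 0.
  have [j' [i']] := plucker_shear_neq0 nu zP; rewrite DS.
  by apply: contra => /eqP ->; rewrite mul0r.
(* [D * P] is a minor of integer vectors, hence a nonzero integer. *)
have DP1 : 1 <= `|D| * `|P|.
  rewrite -normrM /P -plucker_intr -DP plucker_intr -intr_norm ler1z.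
  rewrite -gtz0_ge1 normr_gt0 -(intr_eq0 R) -plucker_intr DP plucker_intr.
  by rewrite mulf_neq0.
have := plucker_shear_le nu j i zP; rewrite DS -/w normrM => bound.
have P_gt0 : 0 < `|P| by rewrite normr_gt0.
have w_gt0 : 0 < `|w| by rewrite normr_gt0.
have : `|w| / `|P| <= `|D| * `|w|.
  by rewrite ler_pdivrMr // mulrAC ler_peMl // ltW.
lra.
Qed.
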